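(* Let $\langle P,\le\rangle$ be a poset of cofinality $\lambda>\operatorname{cf}(\lambda)=\kappa$. The following are equivalent: (a) There exists $\mathcal A=\langle A_\alpha\mid\alpha<\kappa\rangle$ with $\{A_\alpha\mid\alpha<\kappa\}\subseteq[P]^{<\lambda}$ such that $\mathcal A$ is an antichain sequence of length $\kappa$ and cofinality $\lambda$; (b) There exists a stable subset $P'\subseteq P$; (c) There exists $Q\in[P]^\lambda$ with $\operatorname{cf}_P(Q)=\lambda$ such that $\operatorname{cf}_P(\overline{\{x\}}\cap Q)<\lambda$ for all $x\in Q$.
   Context: A cardinal $\lambda$ with $\lambda>\operatorname{cf}(\lambda)$ is a singular (in particular infinite) cardinal. For a set $A$ and a cardinal $\mu$, $[A]^{<\mu}:=\{X\subseteq A\mid |X|<\mu\}$ and $[A]^{\mu}:=\{X\subseteq A\mid |X|=\mu\}$. Let $\langle P,\le\rangle$ be a poset (partially ordered set). For $A\subseteq P$, the downward closure of $A$ is $\underline{A}:=\{x\in P\mid\exists y\in A\,(x\le y)\}$, the upward closure of $A$ is $\overline{A}:=\{x\in P\mid\exists y\in A\,(y\le x)\}$, and the external cofinality of $A$ is $\operatorname{cf}_P(A):=\min\{|B|\mid B\subseteq P,\ A\subseteq\underline{B}\}$. The cofinality of the poset is $\operatorname{cf}(P,\le)=\operatorname{cf}_P(P)$. Elements $x,y\in P$ are incomparable iff $x\not\le y$ and $y\not\le x$; $A\subseteq P$ is an antichain iff all distinct $x,y\in A$ are incomparable. Stable subset: for $P$ of cofinality $\lambda>\operatorname{cf}(\lambda)=\kappa$,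 a subset $P'\in[P]^\lambda$ is stable iff $\operatorname{cf}_P(P'\setminus\overline{X})=\lambda$ for all $X\in[P']^{<\kappa}$. Antichain sequence: a family $\mathcal A=\langle A_\alpha\mid\alpha<\kappa\rangle$ of mutually disjoint subsets of $P$ is an antichain sequence iff (i) $|A_\beta|\le|A_\alpha|$ for all $\beta<\alpha<\kappa$; and (ii) any $X\subseteq\bigcup_{\alpha<\kappa}A_\alpha$ such that $|X\cap A_\alpha|\le1$ for all $\alpha<\kappa$ is an antichain. Its length is $\kappa$ and its cofinality is $\operatorname{cf}_P(\bigcup_{\alpha<\kappa}A_\alpha)$. *)

(* Defs.v *)
From mathcomp Require Import all_boot all_order.
From mathcomp Require Import mathcomp_extra boolp classical_sets functions.
From mathcomp Require Import cardinality.
From mathcomp Require wochoice.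

Set Implicit Arguments.
Unset Strict Implicit.
Unset Printing Implicit Defensive.

Local Open Scope classical_set_scope.
Local Open Scope card_scope.
Local Open Scope order_scope.

Definition card_lt T U (A : set T) (B : set U) := (A #<= B) && (A #!= B).
Notation "A '#<' B" := (card_lt A B)
  (at level 79, format "A  '#<'  B") : card_scope.

(* A cardinal is an initial ordinal, presented as a well-ordered type; as a
   size it stands for the cardinality of [set: L]. *)
Definition is_cardinal d (L : orderType d) :=
  wochoice.well_order (<=%O : rel L) /\
  forall x : L, [set y | y < x] #< [set: L].

(* The downward closure is [down] of classical_sets. *)
Definition up d (P : porderType d) (A : set P) : set P :=
  [set x | exists y, A y /\ y <= x].

(* [is_cf A C] says that cf_P(A) is the cardinality of C. *)
Definition is_cf d (P : porderType d) U (A : set P) (C : set U) :=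
  (exists B : set P, A `<=` down B /\ B #= C) /\
  (forall B : set P, A `<=` down B -> C #<= B).

Definition cf_lt d (P : porderType d) U (A : set P) (C : set U) :=
  exists B : set P, is_cf A B /\ B #< C.

Definition is_antichain d (P : porderType d) (A : set P) :=
  forall x y, A x -> A y -> x != y -> x >< y.

Definition stable d (P : porderType d) (L K : Type) (S : set P) :=
  S #= [set: L] /\
  forall X : set P, X `<=` S -> X #< [set: K] -> is_cf (S `\` up X) [set: L].

Definition antichain_seq dK (K : orderType dK) d (P : porderType d)
    (A : K -> set P) :=
  [/\ trivIset [set: K] A,
      forall b a : K, b < a -> A b #<= A a &
      forall X : set P, X `<=` \bigcup_a A a ->
        (forall a, is_subset1 (X `&` A a)) -> is_antichain X].

(* Main.v *)
(* Call a set small when it is covered, from above, by fewer than L elements of P.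
   Unions of fewer than L sets with a uniform bound on their covers are small, and
   since L is singular a set that is not small, split into K pieces, has pieces of
   external cofinality beyond any given cardinal below L.
   (a) => (b): in the union S of an antichain sequence, the elements above a point
   of A_a lie in A_a, so up X meets S in fewer than cf L of the A_a.
   (b) => (c): let S be stable. If some X of size less than cf L makes
   Q = S \ up X satisfy (c), stop. Otherwise pick recursively x_a in S, not above
   any x_c with c < a, with not-small cone T_a = up x_a minus all earlier cones,
   and pieces of the T_a of increasing cofinality: an element of the a-th piece
   lies below none of the elements of the later ones.
   (c) => (a): the A_a are chosen recursively, of increasing cofinality, among the
   elements of Q incomparable with all earlier A_c; each A_a has a uniform bound
   on cf_P (up y `&` Q), y in A_a, so that not all of Q is ever excluded. *)
Require Import Defs.
From mathcomp Require Import all_boot all_order.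
From mathcomp Require Import mathcomp_extra boolp classical_sets functions.
From mathcomp Require Import cardinality.
From mathcomp Require wochoice.

Import Order.TTheory.

Local Open Scope order_scope.
Local Open Scope classical_set_scope.
Local Open Scope card_scope.

Set Implicit Arguments.
Unset Strict Implicit.
Unset Printing Implicit Defensive.

(** * Comparison of cardinalities *)

(** [R] need not be functional, since values are chosen afterwards; this spares default values when
    an injection is built. *)
Lemma card_le_relP T U (A : set T) (B : set U) :
  A #<= B <-> exists R : T -> U -> Prop,
    (forall x, A x -> exists2 y, B y & R x y) /\
    (forall x x' y, A x -> A x' -> R x y -> R x' y -> x = x').
Proof.
split=> [/card_leP[f]|[R [Rtot Rinj]]].
  exists (fun x y => exists a : A, val a = x /\ val (f a) = y); split.
    move=> x Ax; exists (val (f (SigSub (mem_set Ax)))); first exact: set_valP.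
    by eexists; split; last reflexivity.
  move=> x x' y _ _ [a [<- fa]] [b [<- fb]]; congr val.
  by apply: (@inj _ _ _ f); rewrite ?inE//; apply: val_inj; rewrite fa fb.
have g (a : A) : {b : B | R (val a) (val b)}.
  apply: cid; have [y By Ry] := Rtot _ (set_valP a).
  by exists (SigSub (mem_set By)).
apply/card_leP/injfunPex; exists (fun a => sval (g a)) => // a b _ _ gab.
apply: val_inj; apply: Rinj (set_valP a) (set_valP b) (svalP (g a)) _.
by rewrite gab; exact: (svalP (g b)).
Qed.

Lemma card_le_inj T U (A : set T) (B : set U) (f : T -> U) :
  set_fun A B f -> set_inj A f -> A #<= B.
Proof.
move=> fAB finj; apply/card_le_relP; exists (fun x y => f x = y); split.
  by move=> x Ax; exists (f x) => //; exact: fAB.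
by move=> x x' y Ax Ax' <- /esym; apply: finj; rewrite inE.
Qed.

Lemma card_le_ex_inj T U (A : set T) (B : set U) : A !=set0 -> A #<= B ->
  exists2 f : T -> U, set_fun A B f & set_inj A f.
Proof.
move=> [x0 Ax0] /card_le_relP[R [Rtot Rinj]].
have [y0 By0 _] := Rtot x0 Ax0.
have /choice[f fP] : forall x, exists y, A x -> B y /\ R x y.
  move=> x; have [/Rtot[y By Rxy]|nAx] := pselect (A x); first by exists y.
  by exists y0.
exists f => [x /fP[]//|x y /set_mem Ax /set_mem Ay fxy].
apply: (Rinj x y (f x)) => //; first exact: (fP x Ax).2.
by rewrite fxy; exact: (fP y Ay).2.
Qed.

(* Zorn's lemma on the sets of choice functions of [F] that pairwise differ at
   every index: if no [F i] were exhausted by the values at [i] of a maximal such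
   set, one more choice function could be added. *)
Lemma ex_card_min I T (D : set I) (F : I -> set T) : D !=set0 ->
  exists2 i, D i & forall j, D j -> F i #<= F j.
Proof.
move=> [i0 Di0].
pose P (X : set (I -> T)) := (forall f i, X f -> D i -> F i (f i)) /\
  (forall f g i, X f -> X g -> D i -> f i = g i -> f = g).
have [|X [[XF Xinj] Xmax]] := @Zorn_bigcup _ P.
  move=> C CP Ctot; split=> [f i [X CX Xf]|f g i [X CX Xf] [Y CY Yg]].
    exact: (CP _ CX).1.
  have [XY|YX] := Ctot _ _ CX CY.
    by apply: (CP _ CY).2 => //; exact: XY.
  by apply: (CP _ CX).2 => //; exact: YX.
suff [i Di iX] : exists2 i, D i & forall t, F i t -> exists2 f, X f & f i = t.
  exists i => // j Dj; apply/card_le_relP.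
  exists (fun t u => exists f, [/\ X f, f i = t & f j = u]); split.
    by move=> t /iX[f Xf fit]; exists (f j); [exact: XF | exists f].
  move=> t t' u _ _ [f [Xf <- fj]] [g [Xg <- gj]].
  by rewrite (Xinj f g j)// fj gj.
apply: contrapT => noi.
have new i : exists t, D i -> F i t /\ forall f, X f -> f i <> t.
  have [Di|nDi] := pselect (D i); last first.
    suff [t _] : [set: T] !=set0 by exists t.
    by apply: contrapT => noT; apply: noi; exists i0 => // t; case: noT; exists t.
  apply: contrapT => not; apply: noi; exists i => // t Ft.
  apply: contrapT => nof; apply: not; exists t => _; split=> // f Xf fit.
  by apply: nof; exists f.
have [h hP] := choice new.
apply: (Xmax (X `|` [set h])).
  split; first by move=> f; left.
  by move=> /(_ h (or_intror erefl)) /((hP _ Di0).2 _).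
split=> [f i [Xf|->] Di|f g i [Xf|->] [Xg|->] Di fg //].
- exact: XF.
- exact: (hP _ Di).1.
- exact: Xinj fg.
- by have /(_ _ Xf)/(_ fg) := (hP _ Di).2.
- by have /(_ _ Xg)/(_ (esym fg)) := (hP _ Di).2.
Qed.

(** Tagging places both sets in [T + U], where a family of two sets has a smallest member. *)
Lemma card_le_total T U (A : set T) (B : set U) : A #<= B \/ B #<= A.
Proof.
pose F (b : bool) : set (T + U) := if b then inl @` A else inr @` B.
have FA : F true #= A by apply: inj_card_eq => x y _ _ [].
have FB : F false #= B by apply: inj_card_eq => x y _ _ [].
have [|[] _ le] := @ex_card_min _ _ [set: bool] F; first by exists true.
  by left; rewrite -(card_le_eql FA) -(card_le_eqr FB); exact: le.
by right; rewrite -(card_le_eqr FA) -(card_le_eql FB); exact: le.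
Qed.

Lemma card_ltP T U (A : set T) (B : set U) : A #< B <-> ~ (B #<= A).
Proof.
rewrite /card_lt card_eq_le negb_and.
split=> [/andP[-> /orP[/negP//|/negP//]]|nBA].
have [AB|//] := card_le_total A B.
by rewrite AB/=; apply/negP.
Qed.

Lemma card_le_lt_trans T U V (A : set T) (B : set U) (C : set V) :
  A #<= B -> B #< C -> A #< C.
Proof.
move=> AB /card_ltP nCB; apply/card_ltP => CA.
exact/nCB/card_le_trans/AB.
Qed.

Lemma card_lt_le_trans T U V (A : set T) (B : set U) (C : set V) :
  A #< B -> B #<= C -> A #< C.
Proof.
move=> /card_ltP nBA BC; apply/card_ltP => CA.
exact/nBA/card_le_trans/CA.
Qed.

Lemma card_ltW T U (A : set T) (B : set U) : A #< B -> A #<= B.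
Proof. by case/andP. Qed.

(** * Cardinal arithmetic of products and unions *)

Lemma card_le_setX T T' U U' (A : set T) (A' : set T') (B : set U) (B' : set U') :
  A #<= A' -> B #<= B' -> A `*` B #<= A' `*` B'.
Proof.
move=> /card_le_relP[R [Rtot Rinj]] /card_le_relP[S [Stot Sinj]].
apply/card_le_relP; exists (fun p q => R p.1 q.1 /\ S p.2 q.2); split.
  move=> [x y] [/= /Rtot[x' Ax' Rx] /Stot[y' By' Sy]].
  by exists (x', y').
move=> [x y] [x' y'] [z w] /= [/= Ax By] [/= Ax' By'] [Rx Sy] [Rx' Sy'].
by rewrite (Rinj _ _ _ Ax Ax' Rx Rx') (Sinj _ _ _ By By' Sy Sy').
Qed.

Lemma card_le_bigcup_setX I T U (D : set I) (F : I -> set T) (C : set U) :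
  (forall i, D i -> F i #<= C) -> \bigcup_(i in D) F i #<= D `*` C.
Proof.
move=> FC.
have /choice[R RP] : forall i, exists R : T -> U -> Prop, D i ->
    (forall x, F i x -> exists2 y, C y & R x y) /\
    (forall x x' y, F i x -> F i x' -> R x y -> R x' y -> x = x').
  move=> i; have [Di|nDi] := pselect (D i); last by exists (fun _ _ => True).
  by have /card_le_relP[R ?] := FC i Di; exists R.
apply/card_le_relP.
exists (fun x p => [/\ D p.1, F p.1 x & R p.1 x p.2]); split.
  by move=> x [i Di Fx]; have [y Cy Rxy] := (RP i Di).1 _ Fx; exists (i, y).
move=> x x' [i y] _ _ /= [Di Fx Rx] [_ Fx' Rx'].
exact: (RP i Di).2 Rx Rx'.
Qed.

(** Two copies of [D] fit in its square. The square is assumed to embed in [D] so that the lemma can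
    serve inside the proof of [infinite_card_setX]. *)
Lemma card_le_setU_idem T U (D : set U) (A B : set T) : infinite_set D ->
  D `*` D #<= D -> A #<= D -> B #<= D -> A `|` B #<= D.
Proof.
move=> infD DD AD BD.
have twoD : [set: bool] #<= D.
  have /infiniteP/(card_le_trans _) := infD; apply.
  by apply: (@card_le_inj _ _ _ _ nat_of_bool) => // -[] [].
rewrite (_ : A `|` B = \bigcup_b (if b then A else B)); last first.
  by apply/seteqP; split=> [x [?|?]|x [[] _ ?]];
    [exists true|exists false|left|right].
apply: card_le_trans (card_le_trans (card_le_setX twoD (card_lexx D)) DD).
by apply: card_le_bigcup_setX => -[].
Qed.

(* Zorn's lemma on the graphs [G] of injections [D `*` D -> D], [D] an infinite
   subset of [A]. If [A `\` D] contained a copy [D'] of a maximal [D], the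
   injection would extend to [D `|` D'], with the new pairs sent into [D']. *)
Lemma infinite_card_setX T (A : set T) : infinite_set A -> A `*` A #<= A.
Proof.
move=> infA.
pose fld (G : set (T * T * T)) : set T := [set x | exists z, G ((x, x), z)].
(* Infinity is asked of nonempty graphs only, because the union of the empty chain must satisfy [P]
   too. *)
pose P G := [/\ forall p q z, G (p, z) -> G (q, z) -> p = q,
  forall x y z, G ((x, y), z) -> [/\ fld G x, fld G y & fld G z],
  forall x y, fld G x -> fld G y -> exists z, G ((x, y), z),
  fld G `<=` A & G !=set0 -> infinite_set (fld G)].
have fldS G H : G `<=` H -> fld G `<=` fld H.
  by move=> GH x [z Gz]; exists z; exact: GH.
have graph D : D `<=` A -> infinite_set D -> D `*` D #<= D ->
    exists G, [/\ P G, G !=set0 & fld G = D].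
  move=> DA infD /card_le_relP[R [Rtot Rinj]].
  pose G := [set t : T * T * T | [/\ D t.1.1, D t.1.2, D t.2 & R t.1 t.2]].
  have fldG : fld G = D.
    apply/seteqP; split=> [x [z []]//|x Dx].
    by have [z Dz Rz] := Rtot (x, x) (conj Dx Dx); exists z.
  have G0 : G !=set0.
    have [x Dx] := infinite_setN0 infD.
    by move: (Dx); rewrite -fldG => -[z Gz]; exists (x, x, z).
  exists G; split=> //; split; rewrite ?fldG//.
  + by move=> p q z [? ? ? Rp] [? ? ? Rq]; apply: Rinj Rp Rq.
  + by move=> x y z [].
  + by move=> x y Dx Dy; have [z Dz Rz] := Rtot (x, y) (conj Dx Dy); exists z.
have [|G [[Ginj Gfld Gtot GA Ginf] Gmax]] := @Zorn_bigcup _ P.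
  move=> C CP Ctot.
  have common X Y : C X -> C Y -> exists Z, [/\ C Z, X `<=` Z & Y `<=` Z].
    by move=> CX CY; have [XY|YX] := Ctot _ _ CX CY;
      [exists Y | exists X]; split.
  split.
  - move=> p q z [X CX Xp] [Y CY Yq]; have [Z [CZ XZ YZ]] := common _ _ CX CY.
    by have [+ _ _ _ _] := CP _ CZ; apply; [exact: XZ Xp | exact: YZ].
  - move=> x y z [X CX Xp]; have [_ /(_ _ _ _ Xp)[? ? ?] _ _ _] := CP _ CX.
    by split; apply: (@fldS X) => //; exact: bigcup_sup.
  - move=> x y [u [X CX Xx]] [v [Y CY Yy]].
    have [Z [CZ XZ YZ]] := common _ _ CX CY.
    have [_ _ Ztot _ _] := CP _ CZ.
    have [||z Zz] := Ztot x y; last by exists z, Z.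
      by exists u; exact: XZ.
    by exists v; exact: YZ.
  - move=> x [u [X CX Xx]]; have [_ _ _ XA _] := CP _ CX.
    by apply: XA; exists u.
  - move=> [t [X CX Xt]]; have [_ _ _ _ Xinf] := CP _ CX.
    apply: (@sub_infinite_set _ (fld X)); last by apply: Xinf; exists t.
    by apply: fldS; exact: bigcup_sup.
set D := fld G in Gfld Gtot GA Ginf.
have infD : infinite_set D.
  apply: Ginf; apply: contrapT => G0.
  have [h hA /in2TT hinj] := card_le_ex_inj (ex_intro _ 0%N I) ((infiniteP _).1 infA).
  have hN : range h #= [set: nat] by apply: inj_card_eq => m n _ _ /hinj.
  have [||//|H [PH [t Ht] _]] := graph (range h).
  - by move=> _ [n _ <-]; exact: hA.
  - by apply/infiniteP; rewrite (card_le_eqr hN).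
  - move: hN; rewrite card_eq_le => /andP[hN Nh].
    apply: card_le_trans (card_le_setX hN hN) (card_le_trans _ Nh).
    by rewrite setXTT; move: card_nat2; rewrite card_eq_le => /andP[].
  - apply: (Gmax H) => //; split; first by move=> u Gu; case: G0; exists u.
    by move=> /(_ t Ht) Gt; apply: G0; exists t.
have DD : D `*` D #<= D.
  apply/card_le_relP; exists (fun p z => G (p, z)); split.
    by move=> [x y] [/= Dx Dy]; have [z Gz] := Gtot x y Dx Dy; exists z => //;
      have [] := Gfld _ _ _ Gz.
  by move=> p q z _ _; exact: Ginj.
have [AD|DA] := card_le_total (A `\` D) D.
  have {}AD : A #<= D.
    apply: (@card_le_trans _ _ _ (D `|` (A `\` D))).
      by apply: subset_card_le => x Ax; have [?|?] := pselect (D x); [left|right].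
    by apply: card_le_setU_idem => //; exact: card_lexx.
  exact: card_le_trans (card_le_setX AD AD) (card_le_trans DD (subset_card_le GA)).
exfalso.
have D0 := infinite_setN0 infD.
have [f fAD finj] := card_le_ex_inj D0 DA.
have : f @` D #= D by exact: inj_card_eq.
rewrite card_eq_le => /andP[D'D DD'].
set D' := f @` D in D'D DD'.
have D'A : D' `<=` A `\` D by move=> _ [x Dx <-]; exact: fAD.
pose E := D `|` D'.
have ED : E #<= D by apply: card_le_setU_idem => //; exact: card_lexx.
have /card_le_relP[R [Rtot Rinj]] : E `*` E #<= D'.
  exact: card_le_trans (card_le_setX ED ED) (card_le_trans DD DD').
pose H := G `|` [set t | [/\ E t.1.1, E t.1.2, ~ (D t.1.1 /\ D t.1.2),
                            D' t.2 & R t.1 t.2]].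
have fldH : fld H = E.
  apply/seteqP; split=> [x [z [Gz|[]//]]|x [[z Gz]|D'x]].
  - by left; exists z.
  - by exists z; left.
  - have Ex : E x by right.
    have [z D'z Rz] := Rtot (x, x) (conj Ex Ex); exists z; right.
    by split=> //= -[Dx _]; exact: (D'A _ D'x).2.
apply: (Gmax H).
  split; first by move=> t; left.
  move=> HG; have [x Dx] := D0; have : D' (f x) by exists x.
  move=> D'fx; have : fld H (f x) by rewrite fldH; right.
  by move=> /(fldS _ _ HG); exact: (D'A _ D'fx).2.
split; rewrite ?fldH.
- move=> p q z [Gp|[p1 p2 nDp D'z Rp]] [Gq|[q1 q2 nDq D'z' Rq]].
  + exact: Ginj Gp Gq.
  + by case: p Gp => x y /Gfld[_ _ Dz]; have [] := D'A _ D'z'.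
  + by case: q Gq => x y /Gfld[_ _ Dz]; have [] := D'A _ D'z.
  + exact: Rinj Rp Rq.
- move=> x y z [/Gfld[? ? ?]|[? ? _ ? _]]; first by split; left.
  by split=> //; right.
- move=> x y Ex Ey; have [[Dx Dy]|nD] := pselect (D x /\ D y).
    by have [z Gz] := Gtot x y Dx Dy; exists z; left.
  by have [z D'z Rz] := Rtot (x, y) (conj Ex Ey); exists z; right.
- by move=> x [/GA//|/D'A[]].
- by move=> _; apply: (sub_infinite_set _ infD) => x; left.
Qed.

Lemma card_le_bigcup I T U (D : set I) (F : I -> set T) (C : set U) :
  infinite_set C -> D #<= C -> (forall i, D i -> F i #<= C) ->
  \bigcup_(i in D) F i #<= C.
Proof.
move=> infC DC /card_le_bigcup_setX FC; apply: card_le_trans FC _.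
exact: card_le_trans (card_le_setX DC (card_lexx C)) (infinite_card_setX infC).
Qed.

(** The union is finite if [C] and [D] are, and otherwise no larger than the larger of them. The
    single bound [C] is what makes this hold for singular [L]. *)
Lemma card_lt_bigcup I T U V (D : set I) (F : I -> set T) (C : set U) (L : set V) :
  infinite_set L -> D #< L -> C #< L -> (forall i, D i -> F i #<= C) ->
  \bigcup_(i in D) F i #< L.
Proof.
move=> infL DL CL FC; apply/card_ltP => LF.
have [finC|infC] := pselect (finite_set C).
  have [finD|infD] := pselect (finite_set D).
    apply: infL; apply: card_le_finite LF _; apply: bigcup_finite => // i Di.
    exact: card_le_finite (FC i Di) finC.
  have CD : C #<= D.
    by have [//|/card_le_finite/(_ finC)] := card_le_total C D.
  move: DL => /card_ltP; apply; apply: card_le_trans LF _.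
  apply: card_le_bigcup => // i Di; exact: card_le_trans (FC i Di) CD.
have [DC|CD] := card_le_total D C.
  move: CL => /card_ltP; apply; apply: card_le_trans LF _.
  exact: card_le_bigcup.
move: DL => /card_ltP; apply; apply: card_le_trans LF _.
apply: card_le_bigcup => [/(card_le_finite CD)//||i Di]; first exact: card_lexx.
exact: card_le_trans (FC i Di) CD.
Qed.

Lemma card_lt_setU T V (A B : set T) (L : set V) :
  infinite_set L -> A #< L -> B #< L -> A `|` B #< L.
Proof.
move=> infL AL BL.
have [C [CL AC BC]] : exists C : set T, [/\ C #< L, A #<= C & B #<= C].
  by have [AB|BA] := card_le_total A B; [exists B|exists A]; rewrite card_lexx.
rewrite (_ : A `|` B = \bigcup_b (if b then A else B)); last first.
  by apply/seteqP; split=> [x [?|?]|x [[] _ ?]];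
    [exists true|exists false|left|right].
apply: (@card_lt_bigcup _ _ _ _ _ _ C) => // [|[] _ //].
apply/card_ltP => /card_le_finite /(_ finite_finset).
exact: infL.
Qed.

(** * Recursion with choices along a well-order *)

Lemma well_order_wf d (K : orderType d) :
  wochoice.well_order (<=%O : rel K) -> well_founded (fun x y : K => x < y).
Proof.
move=> wo a; apply: contrapT => nacc.
pose bad := [pred x | `[< ~ Acc (fun x y : K => x < y) x >]].
have [|z [[/asboolP nz zmin] _]] := wo bad; first by exists a; exact/asboolP.
apply: nz; constructor => y yz; apply: contrapT => ny.
have /zmin : y \in bad by exact/asboolP.
by rewrite leNgt yz.
Qed.

(** A selector fixed in advance turns the successive choices into a recursion by [Fix]; that its
    values are admissible is proved afterwards, by induction. *)
Lemma wf_dependent_choice d (K : orderType d) T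
    (R : K -> (K -> T) -> T -> Prop) (t0 : T) :
  wochoice.well_order (<=%O : rel K) ->
  (forall a f g t, (forall c, c < a -> f c = g c) -> R a f t -> R a g t) ->
  (forall a f, (forall c, c < a -> R c f (f c)) -> exists t, R a f t) ->
  exists f, forall a, R a f (f a).
Proof.
move=> wo Rloc Rex.
have /choice[g gP] : forall p : K * (K -> T), exists t,
    (exists t, R p.1 p.2 t) -> R p.1 p.2 t.
  move=> p; have [[t Rt]|not] := pselect (exists t, R p.1 p.2 t).
    by exists t.
  by exists t0.
(* The history below [a] is completed by [t0]; [R] does not see the added values. *)
pose ext (a : K) (h : forall c, c < a -> T) (c : K) :=
  if pselect (c < a) is left ca then h c ca else t0.
pose f := Fix (well_order_wf wo) (fun=> T) (fun a h => g (a, ext a h)).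
have fE a : f a = g (a, ext a (fun c _ => f c)).
  rewrite /f Fix_eq// => x h1 h2 h12; congr (g (_, _)); apply/funext => c.
  by rewrite /ext; case: pselect.
exists f; apply: (well_founded_ind (well_order_wf wo)) => a IH.
have fext c : c < a -> f c = ext a (fun c _ => f c) c.
  by move=> ca; rewrite /ext; case: pselect.
rewrite [in X in R _ _ X]fE; apply: (Rloc _ _ _ _ (fun c ca => esym (fext c ca))).
apply: (gP (a, _)); have [t Rt] := Rex _ _ IH.
by exists t; exact: Rloc fext Rt.
Qed.

(** * Sizes below a singular cardinal *)

Section SingularCardinal.
Context (dL dK : Order.disp_t) (L : orderType dL) (K : orderType dK).
Hypothesis cardL : is_cardinal L.
Hypothesis infL : infinite_set [set: L].
Hypothesis cfL : is_cf [set: L] [set: K].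
Hypothesis singL : [set: K] #< [set: L].

Local Notation seg x := [set y | y < x].

Lemma seg_le (x y : L) : x <= y -> seg x #<= seg y.
Proof.
by move=> xy; apply: subset_card_le => z /= zx; exact: lt_le_trans xy.
Qed.

Lemma cofinality_bounded I (D : set I) (f : I -> L) :
  D #< [set: K] -> exists x, forall i, D i -> f i < x.
Proof.
move=> DK; apply: contrapT => nob.
move: DK => /card_ltP; apply; apply: card_le_trans (card_image_le f D).
apply: cfL.2 => x _; apply: contrapT => nx; apply: nob; exists x => i Di.
by rewrite ltNge; apply/negP => xfi; apply: nx; exists (f i); split => //; exists i.
Qed.

(** The sequence inverts an injection of a cofinal set into [K]. The inequality can be strict
    because a segment and one more point never exhaust [L]. *)
Lemma exists_cofinal_seq : exists b : K -> L, forall x, exists k, x < b k.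
Proof.
have nomax x : exists y : L, x < y.
  apply: contrapT => xmax.
  have : seg x `|` [set x] #< [set: L].
    apply: card_lt_setU => //; first exact: cardL.2.
    by apply/card_ltP => /card_le_finite /(_ (finite_set1 x)).
  move=> /card_ltP; apply; apply: subset_card_le => y _.
  have [yx|yx|->] := ltgtP y x; [by left| |by right].
  by case: xmax; exists y.
have [B [LB]] := cfL.1; rewrite card_eq_le => /andP[BK _].
have [x0 _] := infinite_setN0 infL.
have B0 : B !=set0 by have [y [By _]] := LB x0 I; exists y.
have [f _ finj] := card_le_ex_inj B0 BK.
have /choice[b bP] : forall k, exists y, forall x, B x -> f x = k -> y = x.
  move=> k; have [[x Bx fx]|nox] := pselect (exists2 x, B x & f x = k).
    by exists x => y By fy; apply: finj; rewrite ?inE// fx.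
  by exists x0 => x Bx fx; case: nox; exists x.
exists b => x; have [y xy] := nomax x; have [z [Bz yz]] := LB y I.
by exists (f z); rewrite (bP _ z)//; exact: lt_le_trans yz.
Qed.

(** Were [B] smaller than [L], it would bound uniformly the segments whose union is [L], and these
    are indexed by [K], also smaller than [L]. *)
Lemma card_le_cofinal_segs (b : K -> L) T (B : set T) :
  (forall x, exists k, x < b k) ->
  (forall k, seg (b k) #<= B) -> [set: L] #<= B.
Proof.
move=> bcof bB; have [//|/card_ltP BL] := pselect ([set: L] #<= B).
have /card_ltP[] : \bigcup_(k in [set: K]) seg (b k) #< [set: L].
  exact: card_lt_bigcup BL _.
by apply: subset_card_le => x _; have [k] := bcof x; exists k.
Qed.

(* Singular cardinals are limit cardinals: if no segment had size at least that
   of [A], all the segments below a cofinal sequence of length [K] would embed in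
   [A], hence so would their union [L]. *)
Lemma card_lt_ex_seg T (A : set T) :
  A #< [set: L] -> exists x : L, A #<= seg x.
Proof.
have [b bcof] := exists_cofinal_seq.
move=> /card_ltP nLA; apply: contrapT => noseg; apply: nLA.
apply: card_le_cofinal_segs bcof _ => k.
by have [Ak|//] := card_le_total A (seg (b k)); case: noseg; exists (b k).
Qed.

(** Fewer than cf [L] sizes below [L] are bounded by one segment, the uniform bound that
    [card_lt_bigcup] asks for. *)
Lemma card_lt_bigcup_cofinality I T (D : set I) (F : I -> set T) :
  D #< [set: K] -> (forall i, D i -> F i #< [set: L]) ->
  \bigcup_(i in D) F i #< [set: L].
Proof.
move=> DK FL; have [x0 _] := infinite_setN0 infL.
have /choice[f fP] : forall i, exists x : L, D i -> F i #<= seg x.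
  move=> i; have [/FL/card_lt_ex_seg[x Fx]|nDi] := pselect (D i).
    by exists x.
  by exists x0.
have [x fx] := cofinality_bounded f DK.
apply: (card_lt_bigcup infL _ (cardL.2 x)) => [|i Di].
  exact: card_lt_le_trans DK (card_ltW singL).
exact: card_le_trans (fP i Di) (seg_le (ltW (fx i Di))).
Qed.

(** * Sets of small external cofinality *)

Section Poset.
Context (dP : Order.disp_t) (P : porderType dP).
Hypothesis cfP : is_cf [set: P] [set: L].
Implicit Types A B S Q : set P.

Definition cofinality_small A := exists2 B, A `<=` down B & B #< [set: L].

(** By [ex_card_min], the covers of a small set include one of least size. *)
Lemma cf_ltE A : cf_lt A [set: L] <-> cofinality_small A.
Proof.
split=> [[B [[[B' [AB' B'B]] _] BL]]|[B AB BL]].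
  exists B' => //; apply: card_le_lt_trans BL.
  by move: B'B; rewrite card_eq_le => /andP[].
have [|C AC Cmin] := @ex_card_min _ _ [set B | A `<=` down B] id.
  by exists B.
exists C; split; last exact: card_le_lt_trans (Cmin _ AB) BL.
by split; [exists C | exact: Cmin].
Qed.

(** A cofinal subset of [P] of size [L] covers every [A], so only smaller covers have to be
    excluded. *)
Lemma is_cfE A : is_cf A [set: L] <-> ~ cofinality_small A.
Proof.
split=> [[_ Amin] [B AB /card_ltP]|nA]; first by apply; exact: Amin.
split; first by have [B [PB BL]] := cfP.1; exists B; split=> // x _; exact: PB.
by move=> B AB; apply: contrapT => /card_ltP BL; apply: nA; exists B.
Qed.

Lemma subset_down A : A `<=` down A.
Proof. by move=> x Ax; exists x. Qed.

Lemma cofinality_smallS A B :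
  A `<=` B -> cofinality_small B -> cofinality_small A.
Proof. by move=> AB [C BC CL]; exists C => //; exact: subset_trans BC. Qed.

Lemma card_lt_cofinality_small A : A #< [set: L] -> cofinality_small A.
Proof. by move=> AL; exists A => //; exact: subset_down. Qed.

Lemma cofinality_smallU A B :
  cofinality_small A -> cofinality_small B -> cofinality_small (A `|` B).
Proof.
move=> [A' AA' A'L] [B' BB' B'L]; exists (A' `|` B'); last exact: card_lt_setU.
move=> x [/AA'|/BB'] [y [Cy xy]]; exists y; split=> //; [by left|by right].
Qed.

Lemma cofinality_small_bigcup I T (D : set I) (F : I -> set P) (C : set T) :
  D #< [set: L] -> C #< [set: L] ->
  (forall i, D i -> exists2 B, F i `<=` down B & B #<= C) ->
  cofinality_small (\bigcup_(i in D) F i).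
Proof.
move=> DL CL FC.
have /choice[B BP] : forall i, exists B, D i -> F i `<=` down B /\ B #<= C.
  move=> i; have [/FC[B FB BC]|nDi] := pselect (D i); first by exists B.
  by exists set0.
exists (\bigcup_(i in D) B i).
  move=> x [i Di Fx]; have [y [By xy]] := (BP i Di).1 _ Fx.
  by exists y; split=> //; exists i.
by apply: card_lt_bigcup CL _ => // i /BP[].
Qed.

Lemma not_cofinality_small_card S :
  S #<= [set: L] -> ~ cofinality_small S -> S #= [set: L].
Proof.
move=> SL nS; rewrite card_eq_le SL/=; apply: contrapT => /card_ltP SltL.
exact/nS/card_lt_cofinality_small.
Qed.

(** If every piece had a cover no larger than the segment, these covers, indexed by [K], would
    together form a small cover of [S]. *)
Lemma not_cofinality_small_piece S (F : K -> set P) (x : L) :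
  ~ cofinality_small S -> S `<=` \bigcup_k F k ->
  exists k, forall B, F k `<=` down B -> seg x #<= B.
Proof.
move=> nS SF; apply: contrapT => nok; apply/nS/(cofinality_smallS SF).
apply: (cofinality_small_bigcup singL (cardL.2 x)) => k _.
apply: contrapT => noB; apply: nok; exists k => B FB.
by have [//|Bx] := card_le_total (seg x) B; case: noB; exists B.
Qed.

Lemma not_cofinality_small_bigcup (b : K -> L) (F : K -> set P) :
  (forall x, exists k, x < b k) ->
  (forall k B, F k `<=` down B -> seg (b k) #<= B) ->
  ~ cofinality_small (\bigcup_k F k).
Proof.
move=> bcof Fb [B FB /card_ltP]; apply; apply: card_le_cofinal_segs bcof _ => k.
by apply: Fb => x Fx; apply: FB; exists k.
Qed.

Lemma up1P (x y : P) : up [set x] y <-> x <= y.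
Proof. by split=> [[_ [-> //]]|xy]; exists x. Qed.

(** * From antichain sequences to stable sets *)

(** If [a] and [c] differed, [[set x; y]] would meet each piece at most once and be an antichain
    with two comparable elements. *)
Lemma antichain_seq_comparable (A : K -> set P) a c x y :
  antichain_seq A -> A a x -> A c y -> x <= y -> a = c.
Proof.
move=> [triv _ anti] Ax Ay xy; apply: contrapT => ac.
have nxy : x != y.
  by apply/eqP => xy'; apply/ac/(triv a c) => //; exists x; split=> //; rewrite xy'.
suff /(_ x y (or_introl erefl) (or_intror erefl) nxy) :
    is_antichain [set x; y].
  by move=> /negP; apply; rewrite /Order.comparable xy.
apply: anti => [_ [->|->]|i u v]; [by exists a|by exists c|].
move=> [[->|->] iu] [[->|->] iv] //.
  case: ac; transitivity i; [apply: (triv a i)|apply: (triv i c)] => //.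
    by exists x.
  by exists y.
case: ac; transitivity i; [apply: (triv a i)|apply: (triv i c)] => //.
  by exists x.
by exists y.
Qed.

Lemma antichain_seq_stable (A : K -> set P) : (forall a, A a #< [set: L]) ->
  antichain_seq A -> ~ cofinality_small (\bigcup_a A a) ->
  stable L K (\bigcup_a A a).
Proof.
move=> AL antiA nA; split.
  apply: not_cofinality_small_card nA; apply: card_le_bigcup => // [|a _].
    exact: card_ltW.
  exact: card_ltW.
move=> X XA XK; apply/is_cfE => small; apply: nA.
(* Comparable elements share a piece, so elements of [up X] lie only in the pieces met by [X], and
   these are no more numerous than [X]. *)
pose D := [set a | X `&` A a !=set0].
have DK : D #< [set: K].
  apply: card_le_lt_trans XK; apply/card_le_relP.
  exists (fun a x => A a x); split=> [a [x [Xx Ax]]|a c x _ _ Aa Ac].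
    by exists x.
  by apply: (antichain_seq_comparable antiA Aa Ac).
have /card_lt_cofinality_small AD : \bigcup_(a in D) A a #< [set: L].
  exact: card_lt_bigcup_cofinality.
apply: cofinality_smallS (cofinality_smallU small AD) => y [c _ Ay].
have [[x [Xx xy]]|nXy] := pselect (up X y); last by left; split=> //; exists c.
right; have [a _ Ax] := XA _ Xx.
have ac := antichain_seq_comparable antiA Ax Ay xy.
by exists c => //; exists x; split=> //; rewrite -ac.
Qed.

(** * From stable sets to large sets with small cones *)

Lemma stable_exists_up_small S : is_cardinal K -> stable L K S ->
  exists Q : set P, [/\ Q #= [set: L], ~ cofinality_small Q &
    forall x, Q x -> cofinality_small (up [set x] `&` Q)].
Proof.
move=> cardK [SL Sstab].
have [b bcof] := exists_cofinal_seq.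
have SleL : S #<= [set: L] by move: SL; rewrite card_eq_le => /andP[].
have Sbig X : X `<=` S -> X #< [set: K] -> ~ cofinality_small (S `\` up X).
  by move=> XS XK; apply/is_cfE; exact: Sstab.
have QL Q : Q `<=` S -> ~ cofinality_small Q -> Q #= [set: L].
  move=> QS; apply: not_cofinality_small_card.
  exact: card_le_trans (subset_card_le QS) SleL.
have [[X [XS XK Xsmall]]|noX] := pselect (exists X,
    [/\ X `<=` S, X #< [set: K] & forall x, (S `\` up X) x ->
        cofinality_small (up [set x] `&` (S `\` up X))]).
  have big := Sbig _ XS XK; exists (S `\` up X); split=> //.
  by apply: QL => // x [].
have S0 : S !=set0 by apply: infinite_setN0; rewrite (eq_finite_set SL).
have [p0 _] := S0.
pose R a (f : K -> P) t := let T := S `\` up (f @` seg a) in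
  T t /\ ~ cofinality_small (up [set t] `&` T).
have [| |x xR] := @wf_dependent_choice _ K _ R p0 cardK.1.
(* The second goal is that a value always exists: otherwise the earlier values, fewer than [K],
   would form an [X] excluded by [noX]. *)
- move=> a f g t fg; rewrite /R (_ : f @` seg a = g @` seg a)//.
  by apply: eq_imagel => c; exact: fg.
- move=> a f fR; apply: contrapT => not; apply: noX; exists (f @` seg a); split.
  + by move=> _ [c ca <-]; have [[]] := fR c ca.
  + exact: card_le_lt_trans (card_image_le _ _) (cardK.2 a).
  + by move=> t Tt; apply: contrapT => nt; apply: not; exists t.
pose T a := up [set x a] `&` (S `\` up (x @` seg a)).
have [e _ einj] := card_le_ex_inj S0 SleL.
(* The injection [e] into [L] cuts [T a] into pieces smaller than [L], indexed by [K]. *)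
pose F a k := T a `&` [set t | e t < b k].
have /choice[m mP] a : exists k, forall B, F a k `<=` down B -> seg (b a) #<= B.
  apply: (not_cofinality_small_piece _ (xR a).2) => t Tt.
  by have [k ek] := bcof (e t); exists k.
have FL a k : F a k #< [set: L].
  apply: card_le_lt_trans (cardL.2 (b k)); apply: (card_le_inj (f := e)).
    by move=> t [].
  move=> s t /set_mem[[_ [Ss _]] _] /set_mem[[_ [St _]] _].
  by apply: einj; rewrite inE.
pose Q := \bigcup_a F a (m a).
have Qbig : ~ cofinality_small Q by exact: not_cofinality_small_bigcup bcof mP.
exists Q; split=> //; first by apply: QL => // t [a _ [[_ []]]].
move=> y [a _ [[/up1P xay _] _]].
(* Elements of [Q] above [y] are above [x a], hence in no [T c] with [c] beyond [a]; the pieces up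
   to [a] have fewer than [L] elements together. *)
have : \bigcup_(c in seg a) F c (m c) `|` F a (m a) #< [set: L].
  apply: card_lt_setU => //.
  by apply: card_lt_bigcup_cofinality => //; exact: cardK.2.
move=> /card_lt_cofinality_small; apply: cofinality_smallS.
move=> z [/up1P yz [c _ Fz]].
have [ca|ac|cae] := ltgtP c a; [by left; exists c| |by right; rewrite -cae].
have [[_ [_ nz]] _] := Fz; case: nz; exists (x a); split; first by exists a.
exact: le_trans yz.
Qed.

(** * From small cones to antichain sequences *)

Lemma up_small_exists_antichain_seq Q : is_cardinal K ->
  Q #= [set: L] -> ~ cofinality_small Q ->
  (forall x, Q x -> cofinality_small (up [set x] `&` Q)) ->
  exists A : K -> set P, [/\ forall a, A a #< [set: L], antichain_seq A &
    ~ cofinality_small (\bigcup_a A a)].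
Proof.
move=> cardK QL Qbig Qup.
have [b bcof] := exists_cofinal_seq.
have [x0 _] := infinite_setN0 infL.
have Q0 : Q !=set0 by apply: infinite_setN0; rewrite (eq_finite_set QL).
have [e _ einj] : exists2 e : P -> L, set_fun Q [set: L] e & set_inj Q e.
  by apply: card_le_ex_inj => //; move: QL; rewrite card_eq_le => /andP[].
(* The rank [r x] bounds the size of some cover of the part of [Q] above [x]. *)
have /choice[r rP] : forall x, exists l : L, Q x ->
    exists2 B, up [set x] `&` Q `<=` down B & B #<= seg l.
  move=> x; have [/Qup[B xB /card_lt_ex_seg[l Bl]]|nQx] := pselect (Q x).
    by exists l => _; exists B.
  by exists x0.
(* Bounded ranks on [Y] keep the recursion going; the lower bound on the covers of [Y] will make the
   union of all the sets large. *)
pose R a (A : K -> set P) Y := [/\ Y `<=` Q, Y #< [set: L],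
  exists l, forall y, Y y -> r y < l,
  forall c x y, c < a -> A c x -> Y y -> x >< y &
  (forall c, c < a -> A c #<= Y) /\ forall B, Y `<=` down B -> seg (b a) #<= B].
have [| |A AR] := @wf_dependent_choice _ K _ R set0 cardK.1.
- move=> a A A' Y AA' [YQ YL Yr AY [leAY Yb]]; split=> //.
    by move=> c x y ca; rewrite -AA'//; exact: AY.
  by split=> // c ca; rewrite -AA'//; exact: leAY.
- move=> a A AR.
  pose Z := \bigcup_(c in seg a) A c.
  have ZL : Z #< [set: L].
    by apply: card_lt_bigcup_cofinality => [|c /AR[]//]; exact: cardK.2.
  have ZQ : Z `<=` Q by move=> x [c /AR[AQ _ _ _ _]]; exact: AQ.
  have [l Zl] : exists l, forall z, Z z -> r z < l.
    have /choice[h hP] : forall c, exists l, c < a -> forall y, A c y -> r y < l.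
      move=> c; have [/AR[_ _ [l Al] _ _]|nca] := boolP (c < a); last by exists x0.
      by exists l.
    have [l hl] := cofinality_bounded h (cardK.2 a).
    by exists l => z [c ca Az]; exact: lt_trans (hP c ca z Az) (hl c ca).
  pose T := Q `\` (up Z `|` down Z).
  have Tbig : ~ cofinality_small T.
    (* [Q] lies in the union of [T], the cones over [Z], whose covers are uniformly bounded, and
       [down Z], which [Z] itself covers. *)
    move=> Tsmall; apply: Qbig.
    have upsmall : cofinality_small (\bigcup_(z in Z) (up [set z] `&` Q)).
      apply: (cofinality_small_bigcup ZL (cardL.2 l)) => z Zz.
      have [B zB Bz] := rP z (ZQ z Zz); exists B => //.
      exact: card_le_trans Bz (seg_le (ltW (Zl z Zz))).
    have downsmall : cofinality_small (down Z) by exists Z.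
    have := cofinality_smallU Tsmall (cofinality_smallU upsmall downsmall).
    apply: cofinality_smallS.
    move=> x Qx; have [[z [Zz zx]]|nup] := pselect (up Z x).
      by right; left; exists z => //; split=> //; exact/up1P.
    have [dx|ndown] := pselect (down Z x); first by right; right.
    by left; split=> // -[].
  have [l' Zl'] := card_lt_ex_seg ZL.
  (* Bounding [e] keeps the piece smaller than [L], and bounding [r] bounds its ranks. In the
     maximum below, [l'] takes care of the sizes of the earlier sets and [b a] of the cofinality. *)
  pose F k := T `&` [set t | e t < b k /\ r t < b k].
  have [|k kP] := @not_cofinality_small_piece T F (Order.max l' (b a)) Tbig.
    move=> t Tt; have [k] := bcof (Order.max (e t) (r t)).
    by rewrite gt_max => /andP[ek rk]; exists k.
  exists (F k); split.
  + by move=> t [[]].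
  + apply: card_le_lt_trans (cardL.2 (b k)); apply: (card_le_inj (f := e)).
      by move=> t [_ []].
    move=> s t /set_mem[[Qs _] _] /set_mem[[Qt _] _].
    by apply: einj; rewrite inE.
  + by exists (b k) => t [_ []].
  + move=> c x y ca Ax [[_ ny] _]; apply/negP => /orP[xy|yx]; apply: ny.
      by left; exists x; split=> //; exists c.
    by right; exists x; split=> //; exists c.
  + split=> [c ca|B FB].
      (* The piece covers itself, so the lower bound on its covers applies to its own size. *)
      apply: card_le_trans (kP _ (@subset_down _)).
      apply: card_le_trans (card_le_trans Zl' (seg_le _)).
        by apply: subset_card_le => x Ax; exists c.
      by rewrite le_max lexx.
    by apply: card_le_trans (seg_le _) (kP _ FB); rewrite le_max lexx orbT.
have inc a c x y : a != c -> A a x -> A c y -> x >< y.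
  rewrite neq_lt => /orP[ac|ca] Ax Ay.
    by have [_ _ _ + _] := AR c; apply; [exact: ac| |].
  by rewrite comparable_sym; have [_ _ _ + _] := AR a; apply; [exact: ca| |].
exists A; split.
- by move=> a; have [] := AR a.
- split.
  + move=> a c _ _ [x [Ax Ay]]; apply/eqP/negPn/negP => ac.
    by have := inc _ _ _ _ ac Ax Ay; rewrite comparablexx.
  + by move=> c a ca; have [_ _ _ _ [+ _]] := AR a; apply.
  + move=> X XA X1 x y Xx Xy xy.
    have [a _ Ax] := XA _ Xx; have [c _ Ay] := XA _ Xy.
    apply: (inc _ _ _ _ _ Ax Ay); apply: contraNneq xy => ac; apply/eqP.
    by rewrite ac in Ax; exact: (X1 c _ _ (conj Xx Ax) (conj Xy Ay)).
- by apply: not_cofinality_small_bigcup bcof _ => a; have [_ _ _ _ []] := AR a.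
Qed.

End Poset.
End SingularCardinal.

Theorem theorem3p4 (dP dL dK : Order.disp_t) (P : porderType dP)
    (L : orderType dL) (K : orderType dK)
    (cardL : is_cardinal L) (cardK : is_cardinal K)
    (infL : infinite_set [set: L])
    (cfL : is_cf [set: L] [set: K]) (singL : [set: K] #< [set: L])
    (cfP : is_cf [set: P] [set: L]) :
  [<-> (* (a) *) exists A : K -> set P,
         [/\ forall a, A a #< [set: L],
             antichain_seq A &
             is_cf (\bigcup_a A a) [set: L]];
       (* (b) *) exists S : set P, stable L K S;
       (* (c) *) exists Q : set P,
         [/\ Q #= [set: L],
             is_cf Q [set: L] &
             forall x, Q x -> cf_lt (up [set x] `&` Q) [set: L]]].
Proof.
tfae.
- move=> [A [AL antiA /(is_cfE cfP) bigA]]; exists (\bigcup_a A a).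
  exact: antichain_seq_stable.
- move=> [S stS].
  have [Q [QL Qbig Qup]] := stable_exists_up_small cardL infL cfL singL cfP cardK stS.
  exists Q; split=> //; first exact/(is_cfE cfP).
  by move=> x /Qup /cf_ltE.
- move=> [Q [QL /(is_cfE cfP) Qbig Qup]].
  have [|A [AL antiA bigA]] :=
    up_small_exists_antichain_seq cardL infL cfL singL cardK QL Qbig.
    by move=> x /Qup /cf_ltE.
  exists A; split=> //; exact/(is_cfE cfP).
Qed.
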